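(* Let $g:(0,\infty)\to(0,\infty)$ be a non-decreasing function, and set $$\Lambda(t)=\int_{2}^{t}\frac{s}{[g(s)]^2}\,ds\quad (t>2),\qquad h(t)=\frac{g(t)}{t}\quad (t>0).$$ Then the following hold as $t\to\infty$: (i) One always has $$\frac{g(t)}{\sqrt{\Lambda(t)}}=O(g(t)).$$ In particular, $$\frac{g(t)}{\sqrt{\Lambda(t)}}=o(g(t))$$ whenever $\Lambda(t)\to\infty$ as $t\to\infty$, i.e., whenever $t/[g(t)]^2$ is not integrable at infinity. (ii) If $h$ is non-decreasing, then $$\frac{g(t)}{\sqrt{\Lambda(t)}}=O\left(g(t)\,\frac{h(t)}{\sqrt{\log t}}\right).$$
   Context: For two positive functions $f_1,f_2$ defined in a neighborhood of $+\infty$, $f_1(t)=O(f_2(t))$ means that there is a constant $c>0$ such that $f_1(t)\le c f_2(t)$ for every $t>0$ sufficiently large, and $f_1(t)=o(f_2(t))$ means that $f_1(t)/f_2(t)\to 0$ as $t\to\infty$. *)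

(* Defs.v *)
From HB Require Import structures.
From mathcomp Require Import all_boot all_order all_algebra.
From mathcomp Require Import all_classical all_reals all_analysis.

Set Implicit Arguments.
Unset Strict Implicit.
Unset Printing Implicit Defensive.

Import Order.TTheory GRing.Theory Num.Theory.
Import numFieldNormedType.Exports.

Local Open Scope classical_set_scope.
Local Open Scope ring_scope.

(* Intended for functions that are positive near +oo, where these agree with
   the norm-based [=O_] and [=o_] of landau.v (lemmas below); landau.v has no
   [filter_on] instance for [pinfty_nbhs]. *)
Definition bigO_pinfty (R : realType) (f1 f2 : R -> R) : Prop :=
  exists2 c : R, 0 < c & \forall t \near +oo, f1 t <= c * f2 t.

Definition littleo_pinfty (R : realType) (f1 f2 : R -> R) : Prop :=
  f1 t / f2 t @[t --> +oo] --> 0.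

Definition integrable_at_pinfty (R : realType) (f : R -> R) : Prop :=
  exists a : R, (@lebesgue_measure R).-integrable `[a, +oo[ (EFin \o f).

Section Functions.
Variables (R : realType) (g : R -> R).

(* Only meaningful for t > 2; it is 0 for t <= 2. *)
Definition Lambda (t : R) : R :=
  \int[@lebesgue_measure R]_(s in `[2, t]) (s / g s ^+ 2).

Definition h (t : R) : R := g t / t.

End Functions.

Canonical pinfty_filter_on (R : realType) : filter_on R :=
  FilterType (pinfty_nbhs R) _.

Lemma bigO_pinftyE (R : realType) (f1 f2 : R -> R) :
  (\forall t \near +oo, 0 < f1 t) -> (\forall t \near +oo, 0 < f2 t) ->
  bigO_pinfty f1 f2 <-> (f1 : R -> R^o) =O_ (pinfty_nbhs R) (f2 : R -> R^o).
Proof.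
move=> p1 p2; split.
- move=> [c c0 H]; apply/eqOP; exists c; split; first exact: gtr0_real.
  move=> k ck; near=> t.
  have f1t : 0 < f1 t by near: t.
  have f2t : 0 < f2 t by near: t.
  rewrite !gtr0_norm//; apply: (@le_trans _ _ (c * f2 t)); first by near: t.
  by rewrite ler_wpM2r// ltW.
- move=> /eqO_exP [c c0 H]; exists c => //; near=> t.
  have f1t : 0 < f1 t by near: t.
  have f2t : 0 < f2 t by near: t.
  by rewrite -[f1 t]gtr0_norm// -[f2 t]gtr0_norm//; near: t.
Unshelve. all: by end_near. Qed.

Lemma littleo_pinftyE (R : realType) (f1 f2 : R -> R) :
  (\forall t \near +oo, 0 < f1 t) -> (\forall t \near +oo, 0 < f2 t) ->
  littleo_pinfty f1 f2 <-> (f1 : R -> R^o) =o_ (pinfty_nbhs R) (f2 : R -> R^o).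
Proof.
move=> p1 p2; split.
- move=> /cvgr0Pnorm_le H; apply/eqoP => e e0; near=> t.
  have f2t : 0 < f2 t by near: t.
  rewrite -ler_pdivrMr ?normr_gt0 ?gt_eqF// -normf_div.
  by near: t; exact: H.
- move=> /eqoP H; apply/cvgr0Pnorm_le => e e0; near=> t.
  have f2t : 0 < f2 t by near: t.
  rewrite normf_div ler_pdivrMr ?normr_gt0 ?gt_eqF//.
  by near: t; exact: H.
Unshelve. all: by end_near. Qed.

(* Main.v *)
Require Import Defs.
From HB Require Import structures.
From mathcomp Require Import all_boot all_order all_algebra.
From mathcomp Require Import all_classical all_reals all_analysis.
From mathcomp Require Import measurable_realfun ring lra.

(** The function s / g s ^+ 2 is nonnegative on `[2, +oo[, so Lambda g is
    nondecreasing there, and upper bounds for g / sqrt (Lambda g) amount to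
    lower bounds for Lambda g.

    For (i), Lambda g t >= Lambda g 3 > 0 once t >= 3 (lemmas [Lambda_le] and
    [Lambda_gt0]), so 1 / sqrt (Lambda g) is bounded; it tends to 0 as soon as
    Lambda g tends to +oo. That divergence of the partial integrals is the same
    as non-integrability at infinity is a general fact on nonnegative functions
    ([ge0_cvgy_Rintegral]), where monotone convergence does the work.

    For (ii), write s / g s ^+ 2 = s^-1 / h g s ^+ 2. When h g is nondecreasing,
    the second factor is at least 1 / h g t ^+ 2 on `[2, t], and integrating
    s^-1 gives Lambda g t >= (ln t - ln 2) / h g t ^+ 2 ([le_Lambda_ln]). For
    t >= 4 the numerator is at least ln t / 2, whence the bound with constant
    sqrt 2. *)

Set Implicit Arguments.
Unset Strict Implicit.
Unset Printing Implicit Defensive.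

Import Order.TTheory GRing.Theory Num.Theory.
Import numFieldNormedType.Exports.

Local Open Scope classical_set_scope.
Local Open Scope ring_scope.

(** * Partial integrals of a nonnegative function *)

Section NonnegativeIntegrals.
Context {R : realType}.
Notation mu := (@lebesgue_measure R).
Implicit Types (f : R -> R) (a b : itv_bound R).

Lemma ge0_le_Rintegral_itv f a b x :
  mu.-integrable [set` Interval a b] (EFin \o f) ->
  (a <= BRight x)%O -> (BRight x <= b)%O ->
  (forall s, s \in Interval a b -> 0 <= f s) ->
  \int[mu]_(s in [set` Interval a (BRight x)]) f s
    <= \int[mu]_(s in [set` Interval a b]) f s.
Proof.
move=> intf ax xb f0; rewrite -subr_ge0 (Rintegral_itvB intf ax xb).
by apply: Rintegral_ge0 => s /(subset_itvr ax) /f0.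
Qed.

(** Partial integrals of a nonnegative function increase with t, so they either
    tend to +oo or stay below some A; in the second case monotone convergence
    along `[a, a + n] bounds the integral over `[a, +oo[ by the same A. *)
Lemma ge0_cvgy_Rintegral f (a : R) :
  (forall s, a <= s -> 0 <= f s) ->
  (forall t, mu.-integrable `[a, t] (EFin \o f)) ->
  (\int[mu]_(s in `[a, t]) f s @[t --> +oo] --> +oo) <->
  ~ integrable_at_pinfty f.
Proof.
move=> f0 intf; split.
- move=> /cvgryPgt dvg [b intb].
  (* f has no sign to the left of a, and b may lie there: compare only past the
     larger of the two, where the tail integral bounds the partial ones. *)
  pose c := Num.max a b.
  have intc : mu.-integrable `]c, +oo[ (EFin \o f).
    apply: integrableS intb => // s /=; rewrite !in_itv/= !andbT.
    by rewrite gt_max => /andP[_ /ltW].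
  pose M := \int[mu]_(s in `[a, c]) f s + \int[mu]_(s in `]c, +oo[) f s.
  near (pinfty_nbhs R) => t.
  have Mt : M < \int[mu]_(s in `[a, t]) f s by near: t; exact: dvg.
  have ct : c <= t by near: t; apply: nbhs_pinfty_ge; exact: num_real.
  move: Mt; rewrite ltNge => /negP; apply.
  have ac : (BLeft a <= BRight c :> itv_bound R)%O.
    by rewrite bnd_simp le_max lexx.
  rewrite -lerBlDl (Rintegral_itvB (intf t) ac) ?bnd_simp//.
  apply: ge0_le_Rintegral_itv => //; rewrite ?bnd_simp// => s.
  by rewrite in_itv/= andbT gt_max => /andP[/ltW/f0].
- move=> nint; apply/cvgryPge => A; apply: contrapT => nA.
  apply: nint; exists a.
  (* One value above A would, by monotonicity, keep all later ones above A. *)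
  have leA t : a <= t -> \int[mu]_(s in `[a, t]) f s <= A.
    move=> at_; apply/ltW; rewrite ltNge; apply/negP => At; apply: nA.
    near=> u; apply: (le_trans At); apply: ge0_le_Rintegral_itv => //.
    + by rewrite bnd_simp; near: u; apply: nbhs_pinfty_ge; exact: num_real.
    + by move=> s; rewrite in_itv/= => /andP[/f0].
  pose F n := `[a, a + n%:R]%classic.
  have mF n : measurable (F n) by exact: measurable_itv.
  have mf n : measurable_fun (F n) f.
    by apply/measurable_EFinP; exact: measurable_int (intf _).
  have mfy : measurable_fun `[a, +oo[ f.
    by rewrite itv_bndy_bigcup_BRight; apply/measurable_fun_bigcup.
  have F_nd : nondecreasing_seq F.
    move=> m n mn; rewrite subsetEset; apply: subset_itvl.
    by rewrite bnd_simp lerD2l ler_nat.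
  apply/integrableP; split; first exact/measurable_EFinP.
  rewrite (_ : integral _ _ _ = \int[mu]_(s in `[a, +oo[) (f s)%:E)%E;
    last first.
    apply: eq_integral => s; rewrite inE/= in_itv/= andbT => as_.
    by rewrite /= ger0_norm// f0.
  apply: (@le_lt_trans _ _ A%:E); last exact: ltry.
  rewrite itv_bndy_bigcup_BRight.
  have Fcvg : (\int[mu]_(s in F n) (f s)%:E @[n --> \oo]
      --> \int[mu]_(s in \bigcup_n F n) (f s)%:E)%E.
    apply: ge0_nondecreasing_set_cvg_integral => // [n|n s].
      by apply: (measurable_int mu); exact: intf.
    by rewrite /F/= in_itv/= lee_fin => /andP[/f0].
  apply: (cvge_to_le Fcvg); apply: nearW => n.
  rewrite -[leLHS]fineK; last first.
    by apply: integrable_fin_num (intf _); exact: measurable_itv.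
  by rewrite lee_fin; apply: leA; rewrite lerDl.
Unshelve. all: by end_near. Qed.

End NonnegativeIntegrals.

(** * Lower bounds for Lambda *)

Lemma invr_sqrt_le (R : realType) (c l L x : R) :
  0 < c -> 0 < l -> 0 < L -> 0 < x -> l / (c * x ^+ 2) <= L ->
  (Num.sqrt L)^-1 <= Num.sqrt c * (x / Num.sqrt l).
Proof.
move=> c0 l0 L0 x0 lL.
rewrite mulrA ler_pdivlMr ?sqrtr_gt0// mulrC ler_pdivrMr ?sqrtr_gt0//.
rewrite -[x]gtr0_norm// -sqrtr_sqr.
rewrite -!sqrtrM ?mulr_ge0 ?sqr_ge0 ?(ltW c0) ?(ltW x0)//.
by rewrite ler_wsqrtr// mulrC -ler_pdivrMr ?mulr_gt0 ?exprn_gt0//.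
Qed.

Section Growth.
Context {R : realType}.
Notation mu := (@lebesgue_measure R).
Variable g : R -> R.
Hypothesis g_pos : forall t : R, 0 < t -> 0 < g t.
Hypothesis g_ndecr : forall s t : R, 0 < s -> s <= t -> g s <= g t.

(** The reciprocal of a monotone function is monotone, hence measurable. *)
Lemma measurable_integrand (t : R) :
  measurable_fun `[2, t] (fun s => s / g s ^+ 2).
Proof.
(* g is only monotone on the positive reals; clipping its argument at 1 makes
   it monotone everywhere without changing it on `[2, t]. *)
pose k s := (g (Num.max s 1))^-1.
have k_ni : nonincreasing_fun k.
  move=> s u su; have s1 : 0 < Num.max s 1 by rewrite lt_max ltr01 orbT.
  have u1 : 0 < Num.max u 1 by rewrite lt_max ltr01 orbT.
  rewrite lef_pV2 ?posrE ?g_pos//; apply: g_ndecr => //.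
  by rewrite ge_max !le_max su lexx orbT.
have mk : measurable_fun `[2, t] (fun s : R => s * k s ^+ 2).
  apply: measurable_funM => //; apply: measurable_funX.
  exact: nonincreasing_measurable.
apply: eq_measurable_fun mk => s; rewrite inE/= in_itv/= => /andP[s2 _].
by rewrite /k exprVn max_l// (le_trans _ s2)// ler1n.
Qed.

Lemma integrand_ge0 (s : R) : 2 <= s -> 0 <= s / g s ^+ 2.
Proof. by move=> s2; rewrite divr_ge0 ?sqr_ge0// (le_trans _ s2). Qed.

Lemma le_div_sqr_g (x y u v : R) : 0 <= x -> x <= y -> 0 < u -> u <= v ->
  x / g v ^+ 2 <= y / g u ^+ 2.
Proof.
move=> x0 xy u0 uv; have v0 : 0 < v by rewrite (lt_le_trans u0).
rewrite ler_pM ?invr_ge0 ?sqr_ge0// lef_pV2 ?posrE ?exprn_gt0 ?g_pos//.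
by rewrite ler_pXn2r ?nnegrE ?(ltW (g_pos _))// g_ndecr.
Qed.

Lemma integrable_integrand (t : R) :
  mu.-integrable `[2, t] (EFin \o (fun s => s / g s ^+ 2)).
Proof.
apply: measurable_bounded_integrable => //.
- by rewrite /= lebesgue_measure_itv/=; case: ifPn => _; rewrite ltry.
- exact: measurable_integrand.
- exists (t / g 2 ^+ 2); split; first exact: num_real.
  move=> M tM s /=; rewrite in_itv/= => /andP[s2 st].
  have s0 : 0 < s by rewrite (lt_le_trans _ s2).
  rewrite ger0_norm ?integrand_ge0// (le_trans _ (ltW tM))//.
  by rewrite le_div_sqr_g// ltW.
Qed.

Lemma Lambda_le (s t : R) : 2 <= s -> s <= t -> Lambda g s <= Lambda g t.
Proof.
move=> s2 st; apply: ge0_le_Rintegral_itv; rewrite ?bnd_simp//.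
- exact: integrable_integrand.
- by move=> u; rewrite in_itv/= => /andP[/integrand_ge0].
Qed.

(** On `[2, 3] the integrand stays above the positive constant 2 / g 3 ^+ 2. *)
Lemma Lambda_gt0 (t : R) : 3 <= t -> 0 < Lambda g t.
Proof.
move=> t3; apply: (@lt_le_trans _ _ (Lambda g 3)); last first.
  by apply: Lambda_le => //; rewrite ler_nat.
have g3 : 0 < g 3 by exact: g_pos.
apply: (@lt_le_trans _ _ (\int[mu]_(s in `[2, 3]) (2 / g 3 ^+ 2))).
  rewrite Rintegral_cst//= lebesgue_measure_itv/= lte_fin ltr_nat/=.
  by rewrite mulr_gt0 ?divr_gt0 ?exprn_gt0//.
apply: le_Rintegral => //.
- apply: measurable_bounded_integrable => //.
    by rewrite /= lebesgue_measure_itv/=; case: ifPn => _; rewrite ltry.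
  exists (2 / g 3 ^+ 2); split; first exact: num_real.
  by move=> M tM s _ /=; rewrite ger0_norm ?ltW// divr_gt0// exprn_gt0.
- exact: integrable_integrand.
- move=> s /=; rewrite in_itv/= => /andP[s2 s3].
  by rewrite le_div_sqr_g// (lt_le_trans _ s2).
Qed.

Hypothesis h_ndecr : forall s t : R, 0 < s -> s <= t -> h g s <= h g t.

Lemma h_gt0 (t : R) : 0 < t -> 0 < h g t.
Proof. by move=> t0; rewrite divr_gt0// g_pos. Qed.

Lemma continuous_invr (t : R) : {within `[2, t], continuous (@GRing.inv R)}.
Proof.
apply: continuous_in_subspaceT => s; rewrite inE/= in_itv/= => /andP[s2 _].
by apply: inv_continuous; rewrite gt_eqF// (lt_le_trans _ s2).
Qed.

Lemma Rintegral_invr (t : R) : 2 < t ->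
  \int[mu]_(s in `[2, t]) s^-1 = ln t - ln 2.
Proof.
move=> t2; rewrite /Rintegral (@continuous_FTC2 _ _ (@ln R))//.
- exact: continuous_invr.
- have t0 : 0 < t by exact: lt_trans t2.
  split=> [s||].
  + rewrite in_itv/= => /andP[s2 _].
    by apply: ex_derive; apply: is_derive1_ln; exact: lt_trans s2.
  + by apply: cvg_at_right_filter; exact: continuous_ln.
  + by apply: cvg_at_left_filter; exact: continuous_ln.
- move=> s; rewrite in_itv/= => /andP[s2 _].
  have s0 : 0 < s by exact: lt_trans s2.
  by rewrite derive1E; have [_ ->] := is_derive1_ln s0.
Qed.

(** The integrand is s^-1 / h g s ^+ 2, and the monotonicity of h g allows
    1 / h g s ^+ 2 to be replaced by its value at the right endpoint. *)
Lemma le_Lambda_ln (t : R) : 2 < t ->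
  (ln t - ln 2) / h g t ^+ 2 <= Lambda g t.
Proof.
move=> t2; rewrite -Rintegral_invr//.
have int_inv : mu.-integrable `[2, t] (EFin \o (@GRing.inv R)).
  apply: continuous_compact_integrable; first exact: segment_compact.
  exact: continuous_invr.
rewrite -RintegralZr//; apply: le_Rintegral => //.
- exact: (integrableZr _ _ int_inv).
- exact: integrable_integrand.
- move=> s /=; rewrite in_itv/= => /andP[s2 st].
  have s0 : 0 < s by rewrite (lt_le_trans _ s2).
  have t0 : 0 < t by rewrite (lt_trans _ t2).
  have -> : s / g s ^+ 2 = s^-1 * (h g s ^+ 2)^-1.
    have gs : g s != 0 by rewrite gt_eqF// g_pos.
    have sn : s != 0 by rewrite gt_eqF.
    by rewrite /h; field; rewrite sn.
  rewrite ler_wpM2l ?invr_ge0 ?(ltW s0)//.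
  rewrite lef_pV2 ?posrE ?exprn_gt0 ?h_gt0//.
  by rewrite ler_pXn2r ?nnegrE ?(ltW (h_gt0 _))// h_ndecr.
Qed.

(** 4 = 2 ^ 2 is where ln 2 becomes at most half of ln t. *)
Lemma le_Lambda_half_ln (t : R) : 4 <= t ->
  ln t / (2 * h g t ^+ 2) <= Lambda g t.
Proof.
move=> t4; have t2 : 2 < t by rewrite (lt_le_trans _ t4)// ltr_nat.
have t0 : 0 < t by exact: lt_trans t2.
apply: le_trans (le_Lambda_ln t2).
rewrite invfM mulrA ler_wpM2r ?invr_ge0 ?sqr_ge0//.
have : ln (2 ^+ 2) <= ln t by rewrite ler_ln ?posrE// -natrX.
rewrite lnXn//; lra.
Qed.

End Growth.

Theorem proposition2p2 (R : realType) (g : R -> R)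
    (g_pos : forall t : R, 0 < t -> 0 < g t)
    (g_ndecr : forall s t : R, 0 < s -> s <= t -> g s <= g t) :
  (* (i) *)
  (bigO_pinfty (fun t => g t / Num.sqrt (Lambda g t)) g
   /\ ((Lambda g t @[t --> +oo] --> +oo) <->
       ~ integrable_at_pinfty (fun t => t / g t ^+ 2))
   /\ ((Lambda g t @[t --> +oo] --> +oo) ->
       littleo_pinfty (fun t => g t / Num.sqrt (Lambda g t)) g))
  /\
  (* (ii) *)
  ((forall s t : R, 0 < s -> s <= t -> h g s <= h g t) ->
   bigO_pinfty (fun t => g t / Num.sqrt (Lambda g t))
               (fun t => g t * (h g t / Num.sqrt (ln t)))).
Proof.
have gt0_Lambda : \forall t \near +oo, 0 < Lambda g t.
  near=> t; apply: (Lambda_gt0 g_pos g_ndecr).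
  by near: t; apply: nbhs_pinfty_ge; exact: num_real.
split; first split; last first.
- move=> h_ndecr; exists (Num.sqrt 2); first by rewrite sqrtr_gt0.
  near=> t.
  have t4 : 4 <= t by near: t; apply: nbhs_pinfty_ge; exact: num_real.
  have t0 : 0 < t by rewrite (lt_le_trans _ t4).
  have lnt : 0 < ln t by rewrite ln_gt0// (lt_le_trans _ t4)// ltr1n.
  have ht : 0 < h g t by exact: h_gt0.
  have Lt : 0 < Lambda g t by near: t.
  rewrite mulrCA ler_wpM2l ?(ltW (g_pos _ t0))//.
  by apply: invr_sqrt_le => //; exact: le_Lambda_half_ln.
- split.
  + apply: ge0_cvgy_Rintegral; first exact: integrand_ge0.
    by move=> t; exact: integrable_integrand.
  + move=> Ly.
    have sqrtLy : Num.sqrt (Lambda g t) @[t --> +oo] --> +oo.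
      apply/cvgryPge => A; near=> t.
      rewrite (le_trans (ler_norm A))// -sqrtr_sqr ler_wsqrtr//.
      by near: t; move/cvgryPge : Ly; apply.
    have : (Num.sqrt (Lambda g t))^-1 @[t --> +oo] --> (0 : R).
      apply/(gtr0_cvgV0 _).2 => //; near=> t.
      by rewrite sqrtr_gt0; near: t.
    apply: cvg_trans; apply: near_eq_cvg; near=> t.
    have t0 : 0 < t by near: t; apply: nbhs_pinfty_gt; exact: num_real.
    have gt : g t != 0 by rewrite gt_eqF// g_pos.
    by rewrite [in RHS]mulrAC divff// mul1r.
- exists (Num.sqrt (Lambda g 3))^-1.
    by rewrite invr_gt0 sqrtr_gt0 Lambda_gt0.
  near=> t.
  have t3 : 3 <= t by near: t; apply: nbhs_pinfty_ge; exact: num_real.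
  have t0 : 0 < t by rewrite (lt_le_trans _ t3).
  rewrite mulrC ler_wpM2r ?(ltW (g_pos _ t0))//.
  rewrite lef_pV2 ?posrE ?sqrtr_gt0 ?Lambda_gt0//.
  by rewrite ler_wsqrtr// Lambda_le// ler_nat.
Unshelve. all: by end_near. Qed.
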